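(* Let $n\ge 1$ and let $a_{0},a_{1},\dots,a_{n}\in\mathbb{Z}$ with $a_{0}a_{n}\neq 0$, and suppose that $$(a_{0}-a_{2}+a_{4}-\dots)^{2}+(a_{1}-a_{3}+a_{5}-\dots)^{2}=p\cdot q,$$ where $p$ is a prime number and $q$ is a positive integer. If $|a_{0}|>\sum_{i=1}^{n}|a_{i}|\sqrt{(1+q)^i}$, then the polynomial $\sum_{i=0}^{n}a_{i}X^{i}$ is irreducible over $\mathbb{Q}$.
   Context: The alternating sums are $\sum_{i\ge 0}(-1)^i a_{2i}$ and $\sum_{i\ge 0}(-1)^i a_{2i+1}$, with $a_i=0$ for $i>n$. *)

(* Defs.v *)
From mathcomp Require Import all_boot all_order all_algebra.

Set Implicit Arguments.
Unset Strict Implicit.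
Unset Printing Implicit Defensive.

(* Main.v *)
Require Import Defs.
From mathcomp Require Import all_boot all_order all_algebra.
From mathcomp Require Import algC complex.
Import Order.TTheory GRing.Theory Num.Theory.
Local Open Scope ring_scope.

(** Write [f] for the polynomial and [N g] for [|g(i)|^2 = g(i) g(-i)], where
    [g] has integer coefficients.  [N] is multiplicative with values in the
    nonnegative integers, and the hypothesis on the alternating sums says
    [N f = p q] ([gaussian_norm_poly]).

    By the triangle inequality, the dominance of the constant term forces every
    complex root [z] of [f] to satisfy [|z|^2 > 1 + q]
    ([dominant_constant_root]).  Let [g] be a nonconstant integer factor of [f],
    with leading coefficient [c].  Pairing [i] with [-i] gives
    [N g = c^2 * prod (z^2 + 1)] over the roots [z] of [g], and each factor has
    modulus at least [|z|^2 - 1 > q >= 1]; so [N g > q] ([gaussian_norm_gt]).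
    Bounding [|i - z|] on its own would only give [|z| - 1], which is too weak.

    By Gauss's lemma a proper factorisation of [f] over the rationals yields
    [f = g h] with [g] and [h] nonconstant over the integers.  Then
    [N g * N h = p q] while both factors exceed [q], which is impossible: [p]
    divides one of them, so the other divides [q] ([prime_mul_split_leq]). *)

(** Substituting [-1] for the square of the variable in the even and odd parts
    of [g] gives the real and imaginary parts of [g(i)]. *)
Definition gaussian_norm (g : {poly int}) : int :=
  (even_poly g).[-1] ^+ 2 + (odd_poly g).[-1] ^+ 2.

Lemma gaussian_norm_ge0 g : 0 <= gaussian_norm g.
Proof. by rewrite addr_ge0 ?sqr_ge0. Qed.

Lemma horner_sqrN1 {S : comNzRingType} (x : S) (g : {poly int}) :
  x ^+ 2 = -1 ->
  (map_poly intr g).[x] =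
    (even_poly g).[-1]%:~R + (odd_poly g).[-1]%:~R * x.
Proof.
move=> x2; have int_horner (h : {poly int}) :
    (map_poly intr h).[-1] = h.[-1]%:~R :> S.
  by rewrite -[-1]/(- 1%:~R) -rmorphN horner_map.
rewrite -!int_horner -x2 -{1}[g]poly_even_odd.
rewrite rmorphD rmorphM /= !map_comp_poly /= map_polyXn map_polyX.
by rewrite hornerD hornerM !horner_comp hornerX hornerXn.
Qed.

(** The number [- x] plays the conjugate of [x], and [g] has integer
    coefficients, so the right-hand side is [|g(i)|^2] for [x] the imaginary
    unit; multiplicativity and the product over the roots both follow from
    this form. *)
Lemma gaussian_normE {S : comNzRingType} (x : S) (g : {poly int}) :
  x ^+ 2 = -1 ->
  (gaussian_norm g)%:~R = (map_poly intr g).[x] * (map_poly intr g).[- x].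
Proof.
move=> x2; rewrite !(horner_sqrN1 _ g) ?sqrrN // mulrN [RHS]mulrC.
by rewrite -subr_sqr exprMn x2 mulrN1 opprK rmorphD !rmorphXn.
Qed.

Lemma gaussian_normM (g h : {poly int}) :
  gaussian_norm (g * h) = gaussian_norm g * gaussian_norm h.
Proof.
apply: (@intr_inj algC).
rewrite rmorphM /= !(gaussian_normE 'i) ?sqrCi // rmorphM !hornerM.
by rewrite mulrACA.
Qed.

Lemma gaussian_norm_poly (n : nat) (a : nat -> int) :
  gaussian_norm (\poly_(i < n.+1) a i) =
    (\sum_(i < n.+1 | (2 * i <= n)%N) (-1) ^+ i * a (2 * i)%N) ^+ 2
    + (\sum_(i < n.+1 | (2 * i + 1 <= n)%N) (-1) ^+ i * a (2 * i + 1)%N) ^+ 2.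
Proof.
set f := \poly_(i < _) _.
have size_f : (size f <= n.+1)%N by exact: size_poly.
have size_even : (size (even_poly f) <= n.+1)%N.
  apply: leq_trans (size_even_poly _) _.
  by rewrite leq_uphalf_double (leq_trans size_f) // -addnn leq_addr.
have size_odd : (size (odd_poly f) <= n.+1)%N.
  apply: leq_trans (size_odd_poly _) _.
  by rewrite leq_half_double (leq_trans size_f) // -addnn ltnW // ltnS leq_addr.
rewrite /gaussian_norm (horner_coef_wide _ size_even).
rewrite (horner_coef_wide _ size_odd) [in RHS]big_mkcond.
rewrite [X in _ = _ + X ^+ 2]big_mkcond /=.
congr (_ ^+ 2 + _ ^+ 2); apply: eq_bigr => i _; rewrite mulrC.
  by rewrite coef_even_poly coef_poly ltnS mul2n; case: ifP; rewrite ?mulr0.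
rewrite coef_odd_poly coef_poly ltnS mul2n addn1.
by case: ifP; rewrite ?mulr0.
Qed.

(** A root [z] with [|z| <= s] would express the constant term as minus a sum
    whose modulus is at most the dominated sum. *)
Lemma dominant_constant_root (C : numClosedFieldType) (n : nat)
    (a : nat -> int) (s z : C) :
  0 <= s ->
  \sum_(1 <= i < n.+1) `|a i|%:~R * s ^+ i < `|a 0%N|%:~R ->
  root (map_poly intr (\poly_(i < n.+1) a i)) z -> s < `|z|.
Proof.
move=> s_ge0 dom /rootP fz0.
rewrite real_ltNge ?normr_real ?ger0_real //; apply/negP => le_zs.
move: dom; rewrite real_ltNge ?realz //; last first.
  apply: ger0_real; apply: sumr_ge0 => i _.
  by rewrite mulr_ge0 ?exprn_ge0 ?ler0z.
move/negP; apply.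
have fzE : (a 0%N)%:~R + \sum_(1 <= i < n.+1) (a i)%:~R * z ^+ i = 0 :> C.
  rewrite -[RHS]fz0 (@horner_coef_wide _ n.+1); last first.
    by rewrite (leq_trans (size_poly _ _)) ?size_poly.
  rewrite -(big_mkord xpredT (fun i => (map_poly intr _)`_i * z ^+ i)).
  rewrite [in RHS]big_ltn //= coef_map coef_poly mulr1; congr (_ + _).
  apply: eq_big_nat => i /andP[_ lt_in].
  by rewrite coef_map coef_poly lt_in.
move/eqP: fzE; rewrite addr_eq0 => /eqP a0E.
rewrite intr_norm a0E normrN (le_trans (ler_norm_sum _ _ _)) //.
apply: ler_sum => i _.
by rewrite normrM normrX intr_norm ler_wpM2l // lerXn2r ?nnegrE.
Qed.

Lemma prod_norm_gt (C : numClosedFieldType) (T : eqType) (b : C) (F : T -> C)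
    (r : seq T) :
  1 <= b -> r != [::] -> (forall z, z \in r -> b < `|F z|) ->
  b < `|\prod_(z <- r) F z|.
Proof.
move=> b_ge1; elim: r => // z r IHr _ ltF; rewrite big_cons normrM.
have lt_z : b < `|F z| by apply: ltF; rewrite mem_head.
case: (eqVneq r [::]) => [-> | r_neq0].
  by rewrite big_nil normr1 mulr1.
have lt_r := IHr r_neq0 (fun y ry => ltF y (mem_behead (s := z :: r) ry)).
apply: (lt_le_trans lt_z); rewrite ler_peMr //.
exact: le_trans b_ge1 (ltW lt_r).
Qed.

(** The norm is [c^2] times a nonempty product of factors [z^2 + 1], each of
    modulus at least [|z|^2 - 1 > q], and [c^2 >= 1] because the leading
    coefficient [c] is a nonzero integer. *)
Lemma gaussian_norm_gt (C : numClosedFieldType) (q : nat) (g : {poly int}) :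
  (0 < q)%N -> (1 < size g)%N ->
  (forall z : C, root (map_poly intr g) z -> 1 + q%:R < `|z| ^+ 2) ->
  q%:Z < gaussian_norm g.
Proof.
move=> q_gt0 size_g root_gt; rewrite -(ltr_int C).
have g_neq0 : g != 0 by rewrite -size_poly_gt0 ltnW.
set G := map_poly intr g in root_gt.
have sizeG : size G = size g.
  by rewrite size_map_poly_id0 // intr_eq0 lead_coef_eq0.
have [r Gr] := closed_field_poly_normal G.
have lcG : lead_coef G = (lead_coef g)%:~R.
  by rewrite lead_coef_map_eq // intr_eq0 lead_coef_eq0.
have G_neq0 : G != 0 by rewrite -size_poly_gt0 sizeG ltnW.
have r_neq0 : r != [::].
  apply: contraTneq size_g => r0.
  by rewrite -sizeG Gr r0 big_nil alg_polyC size_polyC -leqNgt leq_b1.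
have root_r z : z \in r -> root G z.
  by rewrite Gr rootZ ?lead_coef_eq0 // root_prod_XsubC.
have normE : (gaussian_norm g)%:~R =
    lead_coef G ^+ 2 * \prod_(z <- r) (z ^+ 2 + 1).
  rewrite (gaussian_normE 'i) ?sqrCi // -/G {1 2}Gr !hornerZ mulrACA -expr2.
  rewrite !horner_prod -big_split /=; congr (_ * _); apply: eq_bigr => z _.
  (* ('i - z) (- 'i - z) = z^2 - 'i^2, which pairs the values at 'i and - 'i. *)
  have -> : z ^+ 2 + 1 = z ^+ 2 - 'i ^+ 2 by rewrite sqrCi opprK.
  by rewrite !hornerXsubC subr_sqr -[RHS]mulrNN opprB opprD [- z - 'i]addrC.
rewrite -[ltRHS]ger0_norm ?ler0z ?gaussian_norm_ge0 // normE normrM normrX.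
have lt_prod : q%:R < `|\prod_(z <- r) (z ^+ 2 + 1)| :> C.
  apply: prod_norm_gt => // [|z /root_r /root_gt lt_z].
    by rewrite ler1n.
  by apply: lt_le_trans (lerB_normD _ _); rewrite normr1 normrX ltrBrDr addrC.
apply: (lt_le_trans lt_prod); rewrite ler_peMl // expr_ge1 //.
by rewrite lcG -intr_norm ler1z -gtz0_ge1 normr_gt0 lead_coef_eq0.
Qed.

(** The prime [p] divides one of the two factors, so the other divides [q]. *)
Lemma prime_mul_split_leq (p q x y : nat) :
  prime p -> (0 < q)%N -> (x * y = p * q)%N -> (x <= q)%N || (y <= q)%N.
Proof.
move=> pr_p q_gt0 xy; have p_gt0 := prime_gt0 pr_p.
have : (p %| x * y)%N by rewrite xy dvdn_mulr.
rewrite Euclid_dvdM // => /orP[] /dvdnP[m def]; apply/orP.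
- right; apply: dvdn_leq => //; apply/dvdnP; exists m.
  by apply/eqP; rewrite -(eqn_pmul2l p_gt0) -xy def mulnA [(p * m)%N]mulnC.
- left; apply: dvdn_leq => //; apply/dvdnP; exists m.
  apply/eqP; rewrite -(eqn_pmul2l p_gt0) -xy def mulnCA.
  by rewrite [(x * p)%N]mulnC mulnCA.
Qed.

(** Gauss's lemma in the form used here: only factorisations over the integers
    need to be excluded, and a constant integer factor is a rational unit. *)
Lemma irreducible_rat_int (f : {poly int}) :
  (1 < size f)%N ->
  (forall g h : {poly int}, f = g * h -> (1 < size g)%N -> (1 < size h)%N ->
     False) ->
  irreducible_poly (map_poly intr f : {poly rat}).
Proof.
move=> size_f no_fact; split=> [|d size_d].
  by rewrite size_map_inj_poly //; exact: intr_inj.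
have f_neq0 : f != 0 by rewrite -size_poly_gt0 ltnW.
move=> /dvdpP_rat_int[g [c c_neq0 def_d] [h def_f]].
have size_g : size d = size g.
  by rewrite def_d size_scale // size_map_inj_poly //; exact: intr_inj.
have [g_neq0 h_neq0] : g != 0 /\ h != 0.
  by apply/norP; rewrite -mulf_eq0 -def_f.
have gt1 : (1 < size g)%N.
  by rewrite ltn_neqAle eq_sym -size_g size_d size_g size_poly_gt0.
case: (leqP (size h) 1) => [size_h | /(no_fact g h def_f gt1) //].
have /size_poly1P[e e_neq0 def_h] : size h == 1%N.
  by rewrite eqn_leq size_h size_poly_gt0.
rewrite def_d def_f def_h mulrC mul_polyC map_polyZ.
apply: (eqp_trans (eqp_scale _ c_neq0)); rewrite eqp_sym eqp_scale //.
by rewrite intr_eq0.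
Qed.

Theorem theorem5p3 (R : rcfType) (n : nat) (a : nat -> int) (p q : nat)
    (hn : (1 <= n)%N) (ha : a 0%N * a n != 0)
    (hp : prime p) (hq : (0 < q)%N)
    (hpq : (\sum_(i < n.+1 | (2 * i <= n)%N) (-1) ^+ i * a (2 * i)%N) ^+ 2
         + (\sum_(i < n.+1 | (2 * i + 1 <= n)%N) (-1) ^+ i * a (2 * i + 1)%N) ^+ 2
         = p%:Z * q%:Z)
    (hdom : \sum_(1 <= i < n.+1) `|a i|%:~R * Num.sqrt ((1 + q%:R) ^+ i)
            < `|a 0%N|%:~R :> R) :
  irreducible_poly (\poly_(i < n.+1) (a i)%:~R : {poly rat}).
Proof.
set f : {poly int} := \poly_(i < n.+1) a i.
have -> : \poly_(i < n.+1) (a i)%:~R = map_poly intr f :> {poly rat}.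
  by apply/polyP => i; rewrite coef_map !coef_poly; case: ifP.
have an_neq0 : a n != 0 by apply: contraNneq ha => ->; rewrite mulr0.
have size_f : size f = n.+1 by rewrite size_poly_eq.
(* The real radicals are moved to R[i], where the polynomial splits. *)
pose s : R[i] := (Num.sqrt (1 + q%:R))%:C%C.
have q1_ge0 : 0 <= 1 + q%:R :> R by rewrite addr_ge0.
have s_ge0 : 0 <= s by rewrite lecR sqrtr_ge0.
have s2 : s ^+ 2 = 1 + q%:R.
  by rewrite -rmorphXn sqr_sqrtr //= rmorphD rmorph1 rmorph_nat.
have sqrtX i : Num.sqrt ((1 + q%:R) ^+ i) = Num.sqrt (1 + q%:R) ^+ i :> R.
  by elim: i => [|i IHi]; rewrite ?sqrtr1 // !exprS sqrtrM // IHi.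
have root_f z : root (map_poly intr f) z -> 1 + q%:R < `|z : R[i]| ^+ 2.
  move=> fz0; rewrite -s2 ltrXn2r ?nnegrE //.
  apply: (dominant_constant_root _ n a) => //.
  have := hdom; rewrite -ltcR rmorph_sum rmorph_int.
  congr (_ < _); apply: eq_bigr => i _.
  by rewrite rmorphM /= rmorph_int -rmorphXn /= sqrtX.
apply: irreducible_rat_int => [|g h def_f size_g size_h].
  by rewrite size_f ltnS.
have norm_f : gaussian_norm g * gaussian_norm h = p%:Z * q%:Z.
  by rewrite -gaussian_normM -def_f gaussian_norm_poly.
have norm_g : q%:Z < gaussian_norm g.
  apply: (gaussian_norm_gt R[i]) => // z gz0; apply: root_f.
  by rewrite def_f rmorphM rootM gz0.
have norm_h : q%:Z < gaussian_norm h.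
  apply: (gaussian_norm_gt R[i]) => // z hz0; apply: root_f.
  by rewrite def_f rmorphM rootM hz0 orbT.
move: norm_f norm_g norm_h.
case: (gaussian_norm g) (gaussian_norm_ge0 g) => // x _.
case: (gaussian_norm h) (gaussian_norm_ge0 h) => // y _ [xy].
rewrite !ltz_nat => lt_x lt_y.
have := prime_mul_split_leq p q x y hp hq xy.
by rewrite leqNgt lt_x leqNgt lt_y.
Qed.
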